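(* Let $\ell\ge 2$ and let $\kappa\in\mathbb{N}_+^\ell$ satisfy $\kappa_1+\cdots+\kappa_\ell=n$. Let $\varrho_\kappa$ denote the log-Sobolev constant for the random transposition chain on the multislice $\mathcal{U}_\kappa$. Then $$\varrho_\kappa^{-1}\le n\cdot\sum_{i=1}^\ell \tfrac12\log_2(4n/\kappa_i).$$
   Context: Here $\mathbb{N}_+$ is the set of positive integers. The multislice is $\mathcal{U}_\kappa=\{u\in[\ell]^n : \text{for each } i\in[\ell],\ u \text{ has exactly } \kappa_i \text{ coordinates equal to } i\}$, and $\pi=\pi_\kappa$ is the uniform distribution on it. $S_n$ acts on strings by $(u^\sigma)_j=u_{\sigma(j)}$, and $\mathrm{Trans}(n)\subseteq S_n$ is the set of all $\binom n2$ transpositions. One step of the chain moves from $u$ to $u^\tau$ with $\tau$ uniform in $\mathrm{Trans}(n)$. A probability density is a function $\phi:\mathcal{U}_\kappa\to\mathbb{R}^{\ge 0}$ with $\mathbf{E}_{u\sim\pi}[\phi(u)]=1$, and $\mathrm{KL}(\phi\pi\,\|\,\pi)=\mathbf{E}_\pi[\phi\ln\phi]$ (with $0\ln 0=0$). The log-Sobolev constant $\varrho_\kappa$ is the largest constant such that $$\mathbf{E}_{u\sim\pi,\ \tau\sim\mathrm{Trans}(n)}\Bigl(\sqrt{\phi(u)}-\sqrt{\phi(u^\tau)}\Bigr)^2\ \ge\ \varrho_\kappa\cdot\mathrm{KL}(\phi\pi\,\|\,\pi)$$ for all probability densities $\phi$ on $\mathcal{U}_\kappa$ ($\tau$ uniform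 and independent of $u$). *)

(* Defs.v *)
From HB Require Import structures.
From mathcomp Require Import all_boot all_order all_fingroup all_algebra.
From mathcomp Require Import all_classical all_reals.
From mathcomp Require Import exp.

Set Implicit Arguments.
Unset Strict Implicit.
Unset Printing Implicit Defensive.

Import Order.TTheory GRing.Theory Num.Theory.

Local Open Scope ring_scope.

Definition multislice (n l : nat) (kappa : 'I_l -> nat) :
    {set {ffun 'I_n -> 'I_l}} :=
  [set u : {ffun 'I_n -> 'I_l} |
    [forall i, #|[set j | u j == i]| == kappa i]].

Definition sact (n l : nat) (u : {ffun 'I_n -> 'I_l}) (s : 'S_n) :
    {ffun 'I_n -> 'I_l} :=
  [ffun j => u (s j)].

Definition Trans (n : nat) : {set 'S_n} :=
  [set tperm p.1 p.2 | p : 'I_n * 'I_n & p.1 != p.2].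

Definition Eunif (R : realType) (T : finType) (A : {set T}) (f : T -> R) : R :=
  (\sum_(x in A) f x) / #|A|%:R.

(* A function on the multislice is encoded by a function on all strings; only
   its values on the multislice are ever constrained or used. *)
Definition density (R : realType) (n l : nat) (kappa : 'I_l -> nat)
    (phi : {ffun 'I_n -> 'I_l} -> R) : Prop :=
  (forall u, u \in multislice n kappa -> 0 <= phi u) /\
  Eunif (multislice n kappa) phi = 1.

(* [0 * ln 0 = 0] holds here, as MathComp-Analysis sets [ln 0 = 0]. *)
Definition KL (R : realType) (n l : nat) (kappa : 'I_l -> nat)
    (phi : {ffun 'I_n -> 'I_l} -> R) : R :=
  Eunif (multislice n kappa) (fun u => phi u * ln (phi u)).

Definition sqrt_energy (R : realType) (n l : nat) (kappa : 'I_l -> nat)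
    (phi : {ffun 'I_n -> 'I_l} -> R) : R :=
  Eunif (multislice n kappa) (fun u =>
    Eunif (Trans n) (fun t =>
      (Num.sqrt (phi u) - Num.sqrt (phi (sact u t))) ^+ 2)).

Definition log_sobolev_set (R : realType) (n l : nat) (kappa : 'I_l -> nat) :
    set R :=
  [set rho | forall phi : {ffun 'I_n -> 'I_l} -> R,
     density kappa phi -> rho * KL kappa phi <= sqrt_energy kappa phi]%classic.
Arguments log_sobolev_set R n {l} kappa.

(* The supremum is attained, see [log_sobolev_constant_max]. *)
Definition log_sobolev_constant (R : realType) (n l : nat)
    (kappa : 'I_l -> nat) : R :=
  sup (log_sobolev_set R n kappa).

Definition log2 (R : realType) (x : R) : R := ln x / ln 2.

Lemma KL_ge0 (R : realType) (n l : nat) (kappa : 'I_l -> nat)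
    (phi : {ffun 'I_n -> 'I_l} -> R) :
  density kappa phi -> 0 <= KL kappa phi.
Proof.
move=> [phi0 phi1]; rewrite /KL /Eunif.
set U := multislice n kappa in phi0 phi1 *.
have U0 : (0 < #|U|)%N.
  rewrite lt0n; apply/negP => /eqP U0; move: phi1; rewrite /Eunif U0 invr0 mulr0.
  by move/esym/eqP; rewrite oner_eq0.
have h u : u \in U -> phi u - 1 <= phi u * ln (phi u).
  move=> /phi0; rewrite le_eqVlt => /predU1P[<-|p0].
    by rewrite mul0r sub0r lerN10.
  have := expR_ge1Dx (- ln (phi u)); rewrite expRN lnK ?posrE // => e.
  have := ler_wpM2l (ltW p0) e.
  rewrite divff ?gt_eqF // mulrDr mulr1 mulrN lerBlDr => {}e.
  by rewrite lerBlDl.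
apply: divr_ge0; last exact: ler0n.
apply: le_trans (ler_sum _ h).
have {}U0 : (#|U|%:R : R) != 0 by rewrite pnatr_eq0 -lt0n.
move: phi1; rewrite /Eunif sumrB sumr_const => /(congr1 ( *%R^~ #|U|%:R)).
by rewrite divfK // mul1r => ->; rewrite subrr.
Qed.

Lemma log_sobolev_constant_max (R : realType) (n l : nat)
    (kappa : 'I_l -> nat) (U1 : (1 < #|multislice n kappa|)%N) :
  log_sobolev_set R n kappa (log_sobolev_constant R n kappa) /\
  forall rho, log_sobolev_set R n kappa rho ->
    rho <= log_sobolev_constant R n kappa.
Proof.
rewrite /log_sobolev_constant; set S := log_sobolev_set R n kappa.
have S0 : S 0.
  move=> phi _; rewrite mul0r /sqrt_energy /Eunif.
  apply: divr_ge0 => //; apply: sumr_ge0 => u _.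
  apply: divr_ge0 => //; apply: sumr_ge0 => t _; exact: sqr_ge0.
set U := multislice n kappa in U1.
have [u0 u0U] : exists u0, u0 \in U by apply/card_gt0P; apply: ltn_trans U1.
have Upos : (0 : R) < #|U|%:R by rewrite ltr0n (ltn_trans _ U1).
pose phi (u : {ffun 'I_n -> 'I_l}) : R := if u == u0 then #|U|%:R else 0.
have phiD : density kappa phi.
  split; first by move=> u _; rewrite /phi; case: ifP.
  rewrite /Eunif (bigD1 u0) //= big1 ?addr0; last first.
    by move=> u /andP[_ /negPf]; rewrite /phi => ->.
  by rewrite /phi eqxx divff // gt_eqF.
have phiKL : 0 < KL kappa phi.
  rewrite /KL /Eunif (bigD1 u0) //= big1 ?addr0; last first.
    by move=> u /andP[_ /negPf]; rewrite /phi => ->; rewrite mul0r.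
  by rewrite /phi eqxx mulrAC divff ?gt_eqF // mul1r ln_gt0 // ltr1n.
have Sub : has_ubound S.
  exists (sqrt_energy kappa phi / KL kappa phi) => rho Srho.
  rewrite ler_pdivlMr //; exact: Srho.
split; last by move=> rho Srho; exact: (ub_le_sup Sub Srho).
move=> psi psiD; have := KL_ge0 psiD; rewrite le_eqVlt => /predU1P[e|p].
  by rewrite -e mulr0; have := S0 _ psiD; rewrite mul0r.
rewrite -ler_pdivlMr //; apply: ge_sup; first by exists 0.
by move=> rho Srho; rewrite ler_pdivlMr //; exact: Srho.
Qed.

(* Main.v *)
Require Import Defs.
From HB Require Import structures.
From mathcomp Require Import all_boot all_order all_fingroup all_algebra.
From mathcomp Require Import all_classical all_reals.
From mathcomp Require Import exp.
From mathcomp Require Import ring lra zify topology normedtype derive.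

Set Implicit Arguments.
Unset Strict Implicit.
Unset Printing Implicit Defensive.

Import Order.TTheory GRing.Theory Num.Theory.
Import numFieldNormedType.Exports.

Local Open Scope ring_scope.

(* Induction on the set S of free coordinates. For each j in S the chain rule
   splits the entropy into the entropy of the colour at j and the entropies on
   the smaller slices where the colour at j is fixed; average over j. The colour
   at j obeys a one-site log-Sobolev inequality
     Ent(f^2) <= (4/3) (2 + ln (1 / p_min)) Var(f),
   and matching a string v having colours (a, b) at (j, k) with its swap turns
   this variance into the part of the energy coming from swaps with j. The
   smaller slices where j is fixed carry the swaps avoiding j, with the constant
   given by induction. As a swap (x y) changes v only if v_x <> v_y, the
   induction closes with the constant (m/2) sum_a log2 (4m / k_a), where m = #|S|
   and k_a counts the colour a in S, by an elementary estimate of how this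
   constant varies when one coordinate is removed. *)

(** * Elementary bounds on the logarithm *)

Lemma le_of_deriv_ge0 (R : realType) (f f' : R -> R) (a b : R) :
  (forall x, a <= x -> is_derive x 1 f (f' x)) ->
  (forall x, a <= x -> 0 <= f' x) -> a <= b -> f a <= f b.
Proof.
move=> df f'0; rewrite le_eqVlt => /predU1P[->//|ab].
have dfo x : x \in `]a, b[ -> is_derive x 1 f (f' x).
  by rewrite in_itv /= => /andP[/ltW ax _]; exact: df.
have cf : ({within `[a, b], continuous f})%classic.
  apply: derivable_within_continuous => x; rewrite in_itv /= => /andP[ax _].
  by have [] := df x ax.
have [c] := MVT ab dfo cf; rewrite in_itv /= => /andP[/ltW ac _] fba.
by rewrite -subr_ge0 fba mulr_ge0 ?f'0// subr_ge0 ltW.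
Qed.

Lemma ln_le_subr1 (R : realType) (x : R) : 0 < x -> ln x <= x - 1.
Proof.
move=> x0; have := @le_ln1Dx R (x - 1).
have -> : 1 + (x - 1) = x by ring.
by apply; lra.
Qed.

Lemma ln_ge_subr_inv (R : realType) (x : R) : 0 < x -> 1 - x^-1 <= ln x.
Proof.
move=> x0; have := @ln_le_subr1 R x^-1; rewrite invr_gt0 lnV ?posrE// => /(_ x0).
lra.
Qed.

(** The gap between the sides vanishes at [1], and its derivative [2 * (y - 1 - ln y)] is
    nonnegative by [ln_le_subr1]. *)
Lemma mul2_ln_le (R : realType) (x : R) : 1 <= x -> 2 * x * ln x <= x ^+ 2 - 1.
Proof.
move=> x1; rewrite -subr_ge0.
pose f (y : R) := y ^+ 2 - 1 - 2 * y * ln y.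
have -> : 0 = f 1 :> R by rewrite /f ln1; ring.
apply: (@le_of_deriv_ge0 R f (fun y => 2 * y - 2 * ln y - 2)) => // y y1.
  have y0 : 0 < y by lra.
  have dln := is_derive1_ln y0.
  apply: is_derive_eq.
  rewrite /GRing.scale /=; field.
  by rewrite gt_eqF.
have := @ln_le_subr1 R y; lra.
Qed.

Lemma subr1_le_ln (R : realType) (x : R) :
  1 <= x -> 2 * (x - 1) <= (x + 1) * ln x.
Proof.
move=> x1; rewrite -subr_ge0.
pose f (y : R) := (y + 1) * ln y - 2 * (y - 1).
have -> : 0 = f 1 :> R by rewrite /f ln1; ring.
apply: (@le_of_deriv_ge0 R f (fun y => ln y + y^-1 - 1)) => // y y1.
  have y0 : 0 < y by lra.
  have dln := is_derive1_ln y0.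
  apply: is_derive_eq.
  rewrite /GRing.scale /=; field.
  by rewrite gt_eqF.
have := @ln_ge_subr_inv R y; lra.
Qed.

Lemma ln2_bounds (R : realType) : 2 / 3 <= ln (2 : R) <= 3 / 4.
Proof.
have h1 := @subr1_le_ln R 2; have h2 := @mul2_ln_le R 2.
by apply/andP; split; lra.
Qed.

(** For [s >= 1], [L] dominates [ln (s ^+ 2)], and what remains is [2 * (2 * s - 1) * ln s <= (3 * s
    - 1) * (s - 1)]; for [s < 1] the coefficient [2] alone suffices. After clearing a positive
    factor, the logarithm bounds leave in both cases a slack of [|s - 1| ^+ 3]. *)
Lemma sqr_ln_le (R : realType) (L s : R) :
    0 <= s -> 0 <= L -> (1 <= s -> ln (s ^+ 2) <= L) ->
  s ^+ 2 * ln (s ^+ 2) - s ^+ 2 + 1 <= (2 + L) * (s - 1) ^+ 2.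
Proof.
rewrite le_eqVlt => /predU1P[<- L0 _|s0 L0].
  by rewrite expr0n /= mul0r; lra.
rewrite lnXn// mulr2n; have [s1 /(_ isT) lL|s1 _] := lerP 1 s.
  have y0 := ln_ge0 s1; have := mul2_ln_le s1.
  move: (ln s) y0 lL => y y0 lL h.
  have {}h : 2 * (2 * s - 1) * y <= (3 * s - 1) * (s - 1).
    rewrite -(ler_pM2l s0); have s10 : 0 <= 2 * s - 1 by lra.
    have := ler_wpM2l s10 h.
    have : 0 <= (s - 1) ^+ 3 by rewrite exprn_ge0// subr_ge0.
    lra.
  have : (y + y) * (s - 1) ^+ 2 <= L * (s - 1) ^+ 2 by rewrite ler_wpM2r ?sqr_ge0.
  lra.
have w1 : 1 <= s^-1 by rewrite invf_ge1// ltW.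
have := subr1_le_ln w1; rewrite lnV ?posrE// => /(ler_wpM2l (ltW s0)).
move: (ln s) => y.
have -> : s * (2 * (s^-1 - 1)) = 2 * (1 - s) by field; rewrite gt_eqF.
have -> : s * ((s^-1 + 1) * - y) = - ((1 + s) * y) by field; rewrite gt_eqF.
move=> h.
have {}h : 2 * s ^+ 2 * y <= (3 * s - 1) * (s - 1).
  have s10 : 0 < 1 + s by lra.
  rewrite -(ler_pM2l s10).
  have := ler_wpM2l (sqr_ge0 s) h.
  have : 0 <= (1 - s) ^+ 3 by rewrite exprn_ge0// subr_ge0 ltW.
  lra.
have : 0 <= L * (s - 1) ^+ 2 by rewrite mulr_ge0 ?sqr_ge0.
lra.
Qed.

(** * Entropy against variance at one site *)

Lemma ler_term_sum (R : realType) (I : finType) (F : I -> R) (i : I) :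
  (forall j, 0 <= F j) -> F i <= \sum_j F j.
Proof. by move=> F0; rewrite (bigD1 i)//= lerDl sumr_ge0. Qed.

(* If the mean M of g is at most 1/2, the crude bound [g ^+ 2 <= 1 / p_min]
   suffices since the variance is at least 3/4; otherwise compare
   [s ^+ 2 * ln (s ^+ 2) - s ^+ 2 + 1] with [(s - 1) ^+ 2] pointwise. *)
Lemma normalized_entropy_le_variance (R : realType) (I : finType)
    (p g : I -> R) (L : R) :
    (forall i, 0 <= p i) -> \sum_i p i = 1 -> (forall i, 0 <= g i) -> 0 <= L ->
    (forall i, 0 < p i -> - ln (p i) <= L) -> \sum_i p i * g i ^+ 2 = 1 ->
  \sum_i p i * (g i ^+ 2 * ln (g i ^+ 2)) <=
  4 / 3 * (2 + L) * (1 - (\sum_i p i * g i) ^+ 2).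
Proof.
move=> p0 p1 g0 L0 pL g1; set M := \sum_i p i * g i.
(* The normalization gives [p i * g i ^+ 2 <= 1], so [g i ^+ 2] is at most [1 / p i]. *)
have lnL i : 0 < p i -> ln (g i ^+ 2) <= L.
  move=> pi0; have [->|gi0] := eqVneq (g i) 0; first by rewrite expr0n ln0.
  have gi2 : 0 < g i ^+ 2 by rewrite exprn_gt0// lt_neqAle eq_sym gi0 g0.
  apply: le_trans (pL i pi0).
  rewrite -lnV ?posrE// ler_ln ?posrE ?invr_gt0// -[leRHS]mul1r ler_pdivlMr//.
  rewrite mulrC -g1; apply: (@ler_term_sum R I (fun j => p j * g j ^+ 2) i) => j.
  by rewrite mulr_ge0 ?sqr_ge0.
have M0 : 0 <= M by apply: sumr_ge0 => i _; rewrite mulr_ge0.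
have var : \sum_i p i * (g i - 1) ^+ 2 = 2 * (1 - M).
  transitivity (\sum_i (p i * g i ^+ 2 - 2 * (p i * g i) + p i)).
    by apply: eq_bigr => i _; ring.
  by rewrite big_split sumrB /= -mulr_sumr g1 p1 -/M; ring.
have M1 : M <= 1.
  have : 0 <= \sum_i p i * (g i - 1) ^+ 2.
    by apply: sumr_ge0 => i _; rewrite mulr_ge0// sqr_ge0.
  by rewrite var; lra.
have [Ms|/ltW Mb] := leP M (1 / 2).
  apply: (@le_trans _ _ L).
    rewrite -[leRHS]mulr1 -g1 mulr_sumr; apply: ler_sum => i _.
    have := p0 i; rewrite le_eqVlt => /predU1P[<-|pi0]; first by rewrite !mul0r mulr0.
    by rewrite mulrA [leRHS]mulrC ler_wpM2l ?lnL// mulr_ge0 ?sqr_ge0.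
  have M4 : M ^+ 2 <= 1 / 4.
    have : 0 <= (1 / 2 - M) * (1 / 2 + M) by rewrite mulr_ge0//; lra.
    lra.
  have : (2 + L) * (3 / 4) <= (2 + L) * (1 - M ^+ 2) by rewrite ler_wpM2l; lra.
  lra.
(* The added terms have mean zero, and they make the summand vanish to second order at [g i = 1]. *)
have -> : \sum_i p i * (g i ^+ 2 * ln (g i ^+ 2)) =
    \sum_i p i * (g i ^+ 2 * ln (g i ^+ 2) - g i ^+ 2 + 1).
  transitivity (\sum_i (p i * (g i ^+ 2 * ln (g i ^+ 2)) - p i * g i ^+ 2 + p i)).
    by rewrite big_split sumrB /= g1 p1 subrK.
  by apply: eq_bigr => i _; ring.
apply: (@le_trans _ _ ((2 + L) * (2 * (1 - M)))).
  rewrite -var mulr_sumr; apply: ler_sum => i _.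
  have := p0 i; rewrite le_eqVlt => /predU1P[<-|pi0]; first by rewrite !mul0r mulr0.
  by rewrite mulrCA ler_wpM2l// sqr_ln_le// => _; exact: lnL.
(* As [M >= 1 / 2], [2 * (1 - M) <= 4 / 3 * (1 - M ^+ 2)]; this is the source of [4 / 3]. *)
have : (2 + L) * ((1 - M) * (3 / 2)) <= (2 + L) * ((1 - M) * (1 + M)).
  by rewrite ler_wpM2l; [|lra|rewrite ler_wpM2l; lra].
lra.
Qed.

(** Both sides are homogeneous of degree two in [g], so [g] may be divided by the root of its second
    moment [N]; if [N = 0], both sides vanish. *)
Lemma entropy_le_variance (R : realType) (I : finType) (p g : I -> R) (L : R) :
    (forall i, 0 <= p i) -> \sum_i p i = 1 -> (forall i, 0 <= g i) -> 0 <= L ->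
    (forall i, 0 < p i -> - ln (p i) <= L) ->
  \sum_i p i * (g i ^+ 2 * ln (g i ^+ 2)) -
    (\sum_i p i * g i ^+ 2) * ln (\sum_i p i * g i ^+ 2) <=
  4 / 3 * (2 + L) * (\sum_i p i * g i ^+ 2 - (\sum_i p i * g i) ^+ 2).
Proof.
move=> p0 p1 g0 L0 pL; set N := \sum_i p i * g i ^+ 2.
have pg0 i : 0 <= p i * g i ^+ 2 by rewrite mulr_ge0 ?sqr_ge0.
have : 0 <= N by exact: sumr_ge0.
rewrite le_eqVlt => /predU1P[N0|N0].
  have pgz i : p i * g i ^+ 2 = 0.
    by apply/eqP; rewrite eq_le pg0 andbT N0; exact: ler_term_sum.
  rewrite -N0 mul0r [X in X - 0]big1 => [|i _]; last by rewrite mulrA pgz mul0r.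
  rewrite [X in X ^+ 2]big1 ?expr0n ?subrr ?mulr0// => i _.
  have /eqP := pgz i; rewrite mulf_eq0 expf_eq0 /= => /orP[]/eqP->.
    by rewrite mul0r.
  by rewrite mulr0.
pose s := Num.sqrt N.
have s0 : 0 < s by rewrite sqrtr_gt0.
have s2 : s ^+ 2 = N by rewrite sqr_sqrtr ?ltW.
have sumg (q : I -> R) (c : R) : \sum_i p i * (q i / c) = (\sum_i p i * q i) / c.
  by rewrite mulr_suml; apply: eq_bigr => i _; rewrite mulrA.
have gs0 i : 0 <= g i / s by rewrite divr_ge0 ?g0 ?(ltW s0).
have gs1 : \sum_i p i * (g i / s) ^+ 2 = 1.
  under eq_bigr do rewrite expr_div_n s2.
  by rewrite sumg divff ?gt_eqF.
have := normalized_entropy_le_variance p0 p1 gs0 L0 pL gs1.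
rewrite sumg expr_div_n s2.
have -> : \sum_i p i * ((g i / s) ^+ 2 * ln ((g i / s) ^+ 2)) =
    (\sum_i p i * (g i ^+ 2 * ln (g i ^+ 2)) - N * ln N) / N.
  rewrite {1}/N mulr_suml -sumrB mulr_suml; apply: eq_bigr => i _.
  rewrite expr_div_n s2; have [->|gi0] := eqVneq (g i) 0.
    by rewrite expr0n /= !(mul0r, mulr0) subrr mul0r.
  have gi2 : 0 < g i ^+ 2 by rewrite exprn_gt0// lt_neqAle eq_sym gi0 g0.
  by rewrite ln_div ?posrE//; ring.
rewrite ler_pdivrMr//.
move=> /le_trans; apply; rewrite le_eqVlt; apply/orP; left; apply/eqP.
by field; rewrite gt_eqF.
Qed.

(** * Local slices and their swaps *)

Definition color_count (n l : nat) (S : {set 'I_n}) (v : {ffun 'I_n -> 'I_l})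
    (a : 'I_l) : nat :=
  #|[set j in S | v j == a]|.

(* The strings obtained from [u] by permuting the coordinates in [S]: fixing
   coordinates in place keeps all the slices of the induction in one type. *)
Definition local_slice (n l : nat) (S : {set 'I_n}) (u : {ffun 'I_n -> 'I_l}) :
    {set {ffun 'I_n -> 'I_l}} :=
  [set v : {ffun 'I_n -> 'I_l} | [forall j, (j \notin S) ==> (v j == u j)] &&
    [forall a, color_count S v a == color_count S u a]].

Lemma local_sliceP (n l : nat) (S : {set 'I_n}) (u v : {ffun 'I_n -> 'I_l}) :
  reflect ((forall j, j \notin S -> v j = u j) /\
           (forall a, color_count S v a = color_count S u a))
          (v \in local_slice S u).
Proof.
rewrite inE; apply: (iffP andP) => -[h1 h2]; split.
- by move=> j jS; apply/eqP; exact: (implyP (forallP h1 j)).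
- by move=> a; apply/eqP; exact: (forallP h2 a).
- by apply/forallP => j; apply/implyP => /h1 ->.
- by apply/forallP => a; apply/eqP.
Qed.

Lemma local_slice_refl (n l : nat) (S : {set 'I_n}) (u : {ffun 'I_n -> 'I_l}) :
  u \in local_slice S u.
Proof. by apply/local_sliceP. Qed.

Lemma sum_color_count (n l : nat) (S : {set 'I_n}) (v : {ffun 'I_n -> 'I_l}) :
  (\sum_a color_count S v a)%N = #|S|.
Proof.
rewrite -sum1_card (partition_big v predT)//=; apply: eq_bigr => a _.
by rewrite sum1dep_card.
Qed.

Lemma color_count_gt0 (n l : nat) (S : {set 'I_n}) (v : {ffun 'I_n -> 'I_l})
    (j : 'I_n) :
  j \in S -> (0 < color_count S v (v j))%N.
Proof. by move=> jS; apply/card_gt0P; exists j; rewrite inE jS eqxx. Qed.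

Lemma color_countD1 (n l : nat) (S : {set 'I_n}) (v : {ffun 'I_n -> 'I_l})
    (j : 'I_n) (a : 'I_l) :
  j \in S -> color_count S v a = ((v j == a) + color_count (S :\ j) v a)%N.
Proof.
move=> jS; rewrite /color_count (cardsD1 j) inE jS; congr (_ + _)%N.
by apply: eq_card => k; rewrite !inE andbA.
Qed.

Lemma sact_tpermK (n l : nat) (x y : 'I_n) :
  involutive (fun v : {ffun 'I_n -> 'I_l} => sact v (tperm x y)).
Proof. by move=> v; apply/ffunP => j; rewrite !ffunE tpermK. Qed.

Lemma tperm_in (n : nat) (S : {set 'I_n}) (x y j : 'I_n) :
  x \in S -> y \in S -> (tperm x y j \in S) = (j \in S).
Proof. by move=> xS yS; case: tpermP => [->|->|]; rewrite ?xS ?yS. Qed.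

Lemma color_count_tperm (n l : nat) (S : {set 'I_n}) (v : {ffun 'I_n -> 'I_l})
    (x y : 'I_n) (a : 'I_l) :
  x \in S -> y \in S ->
  color_count S (sact v (tperm x y)) a = color_count S v a.
Proof.
move=> xS yS; rewrite /color_count -(card_imset _ (@perm_inj _ (tperm x y))).
apply: eq_card => j; rewrite -{1}(tpermK x y j) (mem_imset _ _ perm_inj).
by rewrite !inE !ffunE tpermK tperm_in.
Qed.

Lemma local_slice_tperm (n l : nat) (S : {set 'I_n}) (u v : {ffun 'I_n -> 'I_l})
    (x y : 'I_n) :
  x \in S -> y \in S ->
  (sact v (tperm x y) \in local_slice S u) = (v \in local_slice S u).
Proof.
move=> xS yS; suff h w : w \in local_slice S u ->
    sact w (tperm x y) \in local_slice S u.
  by apply/idP/idP => [/h|/h//]; rewrite sact_tpermK.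
move=> /local_sliceP[h1 h2]; apply/local_sliceP; split => [j jS|a].
  rewrite ffunE tpermD ?h1//; first by apply: contraNneq jS => <-.
  by apply: contraNneq jS => <-.
by rewrite color_count_tperm.
Qed.

(** Once the colour at [j] is fixed, only the colour counts on [S :\ j] remain constrained. The
    induction hypothesis is applied to these fibers. *)
Lemma local_slice_fiber (n l : nat) (S : {set 'I_n})
    (u w : {ffun 'I_n -> 'I_l}) (j : 'I_n) :
  j \in S -> w \in local_slice S u ->
  [set v in local_slice S u | v j == w j] = local_slice (S :\ j) w.
Proof.
move=> jS /local_sliceP[w1 w2]; apply/setP => v; rewrite inE.
apply/andP/local_sliceP => [[/local_sliceP[v1 v2] /eqP vj]|[v1 v2]].
  split => [k|a].
    by rewrite !inE negb_and negbK => /orP[/eqP->//|kS]; rewrite v1// w1.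
  have := v2 a; rewrite -w2 (color_countD1 v a jS) (color_countD1 w a jS) vj.
  exact: addnI.
have vj : v j = w j by rewrite v1// !inE eqxx.
split; last by rewrite vj.
apply/local_sliceP; split => [k kS|a].
  by rewrite v1 ?w1// !inE (negPf kS) andbF.
by rewrite -w2 (color_countD1 v a jS) (color_countD1 w a jS) vj v2.
Qed.

(** Double counting of pairs [(v, k)]: the swap exchanges the colours at [j] and [k], and a string
    with colour [b] at [j] is reached once for every coordinate of [S] where it has colour [a]. *)
Lemma sum_swap (R : realType) (n l : nat) (S : {set 'I_n})
    (u : {ffun 'I_n -> 'I_l}) (j : 'I_n) (a b : 'I_l)
    (f : {ffun 'I_n -> 'I_l} -> R) : j \in S ->
  \sum_(v in local_slice S u | v j == a)
    \sum_(k in S | v k == b) f (sact v (tperm j k)) =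
  (color_count S u a)%:R * \sum_(v in local_slice S u | v j == b) f v.
Proof.
move=> jS; rewrite (exchange_big_dep [in S])//=; last by move=> ? ? _ /andP[].
under eq_bigr => k kS.
  rewrite (reindex_inj (inv_inj (@sact_tpermK n l j k))) /=.
  under eq_bigl => v.
    rewrite local_slice_tperm// !ffunE tpermL tpermR kS /=.
    over.
  under eq_bigr do rewrite sact_tpermK.
  over.
rewrite /=.
rewrite (exchange_big_dep
  [pred v | (v \in local_slice S u) && (v j == b)])/=; last first.
  by move=> k v _ /andP[/andP[-> _] ->].
rewrite mulr_sumr; apply: eq_bigr => v /andP[vU vj].
rewrite (eq_bigl (fun k => k \in [set k in S | v k == a])) => [|k].
  have [_ vu] := local_sliceP _ _ _ vU.
  by rewrite sumr_const -/(color_count S v a) vu mulr_natl.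
by rewrite inE vU vj andbT.
Qed.

(** * Chain rule and entropy of the colour at one coordinate *)

(** This is [#|A|] times the entropy of [f] under the uniform distribution on [A]; without
    normalization it adds up over the cells of a partition. *)
Definition entropy_on (R : realType) (T : finType) (A : {set T}) (f : T -> R) :
    R :=
  \sum_(v in A) f v * ln (f v) -
    (\sum_(v in A) f v) * ln ((\sum_(v in A) f v) / #|A|%:R).

(** The terms in the cell means cancel. The last bracket is [#|A|] times the entropy of the
    conditional mean of [f] given [c]. *)
Lemma entropy_on_chain (R : realType) (T I : finType) (A : {set T})
    (f : T -> R) (c : T -> I) :
  entropy_on A f =
  \sum_a entropy_on [set v in A | c v == a] f +
  (\sum_a (\sum_(v in A | c v == a) f v) *
     ln ((\sum_(v in A | c v == a) f v) / #|[set v in A | c v == a]|%:R) -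
   (\sum_(v in A) f v) * ln ((\sum_(v in A) f v) / #|A|%:R)).
Proof.
rewrite addrA -big_split /= {1}/entropy_on; congr (_ - _).
rewrite (partition_big c predT)//=; apply: eq_bigr => a _.
have bigA (h : T -> R) :
    \sum_(v in [set v in A | c v == a]) h v = \sum_(v in A | c v == a) h v.
  by apply: eq_bigl => v; rewrite inE.
by rewrite /entropy_on !bigA subrK.
Qed.

(** Reverse triangle inequality for vectors whose squared norms are [C * X ^+ 2] and [C * Y ^+ 2].
    The cross term is bounded by the AM-GM inequality with weight [Y / X], for which both squares
    sum to [C * X * Y]. *)
Lemma sqr_sub_norm_le (R : realType) (I : finType) (P : pred I) (x y : I -> R)
    (C X Y : R) :
    0 <= X -> 0 <= Y ->
    \sum_(i | P i) x i ^+ 2 = C * X ^+ 2 -> \sum_(i | P i) y i ^+ 2 = C * Y ^+ 2 ->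
  C * (X - Y) ^+ 2 <= \sum_(i | P i) (x i - y i) ^+ 2.
Proof.
have zero (z : I -> R) : \sum_(i | P i) z i ^+ 2 = 0 -> forall i, P i -> z i = 0.
  move=> /psumr_eq0P h i Pi; apply/eqP; rewrite -sqrf_eq0; apply/eqP.
  by apply: h => // j _; exact: sqr_ge0.
move=> X0 Y0 xX yY.
have sumE : \sum_(i | P i) (x i - y i) ^+ 2 =
    C * X ^+ 2 + C * Y ^+ 2 - \sum_(i | P i) 2 * (x i * y i).
  rewrite -xX -yY -big_split /= -sumrB; apply: eq_bigr => i _; ring.
suff : \sum_(i | P i) 2 * (x i * y i) <= 2 * C * X * Y by rewrite sumE; lra.
have [X1|X1] := eqVneq X 0.
  rewrite big1 ?X1 => [|i Pi]; first by lra.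
  by rewrite (zero x) ?mul0r ?mulr0// xX X1; ring.
have [Y1|Y1] := eqVneq Y 0.
  rewrite big1 ?Y1 => [|i Pi]; first by lra.
  by rewrite (zero y) ?mulr0// yY Y1; ring.
have {}X0 : 0 < X by rewrite lt_neqAle eq_sym X1.
have {}Y0 : 0 < Y by rewrite lt_neqAle eq_sym Y1.
apply: (@le_trans _ _ (\sum_(i | P i) (Y / X * x i ^+ 2 + X / Y * y i ^+ 2))).
  apply: ler_sum => i _; rewrite -subr_ge0.
  have -> : Y / X * x i ^+ 2 + X / Y * y i ^+ 2 - 2 * (x i * y i) =
      (Y * x i - X * y i) ^+ 2 / (X * Y) by field; rewrite X1 Y1.
  by rewrite divr_ge0 ?sqr_ge0// mulr_ge0// ltW.
rewrite big_split /= -!mulr_sumr xX yY le_eqVlt; apply/orP; left; apply/eqP.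
by field; rewrite X1 Y1.
Qed.

(* A colour absent from [S] contributes [ln (m / 0) = ln 0 = 0]. *)
Definition log_deficit (R : realType) (n l : nat) (S : {set 'I_n})
    (v : {ffun 'I_n -> 'I_l}) : R :=
  \sum_a ln (#|S|%:R / (color_count S v a)%:R).

Lemma color_count_le (n l : nat) (S : {set 'I_n}) (v : {ffun 'I_n -> 'I_l})
    (a : 'I_l) : (color_count S v a <= #|S|)%N.
Proof.
by apply: subset_leq_card; apply/fintype.subsetP => j; rewrite inE => /andP[].
Qed.

Lemma ln_color_ratio_ge0 (R : realType) (n l : nat) (S : {set 'I_n})
    (v : {ffun 'I_n -> 'I_l}) (a : 'I_l) :
  0 <= ln (#|S|%:R / (color_count S v a)%:R : R).
Proof.
case: (posnP (color_count S v a)) => [->|k0]; first by rewrite invr0 mulr0 ln0.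
by rewrite ln_ge0// ler_pdivlMr ?ltr0n// mul1r ler_nat color_count_le.
Qed.

Lemma log_deficit_ge0 (R : realType) (n l : nat) (S : {set 'I_n})
    (v : {ffun 'I_n -> 'I_l}) : 0 <= log_deficit R S v.
Proof. by apply: sumr_ge0 => a _; exact: ln_color_ratio_ge0. Qed.

(** Summing [sum_swap] for the constant function over [b] counts every [k] in [S] once. Hence the
    colour at [j] has law [color_count S u a / #|S|]. *)
Lemma card_local_slice_fiber (R : realType) (n l : nat) (S : {set 'I_n})
    (u : {ffun 'I_n -> 'I_l}) (j : 'I_n) (a : 'I_l) : j \in S ->
  #|S|%:R * #|[set v in local_slice S u | v j == a]|%:R =
  (color_count S u a)%:R * #|local_slice S u|%:R :> R.
Proof.
move=> jS.
have card1 (b : 'I_l) : #|[set v in local_slice S u | v j == b]|%:R =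
    \sum_(v in local_slice S u | v j == b) 1 :> R.
  by rewrite -sum1_card natr_sum; apply: eq_bigl => v; rewrite inE.
have -> : #|local_slice S u|%:R =
    \sum_b \sum_(v in local_slice S u | v j == b) 1 :> R.
  rewrite -sum1_card natr_sum.
  by rewrite (partition_big (fun v : {ffun 'I_n -> 'I_l} => v j) predT).
rewrite mulr_sumr.
under eq_bigr do rewrite -(sum_swap _ a _ (fun=> 1))//.
rewrite exchange_big /= card1 mulr_sumr; apply: eq_bigr => v _.
rewrite mulr1 -sum1_card natr_sum.
by rewrite (partition_big v predT).
Qed.

(** The reverse triangle inequality is applied to vectors indexed by pairs [(v, k)]: one entry is
    [g v], the other its value after the swap, whose norm [sum_swap] computes. *)
Lemma fiber_transport (R : realType) (n l : nat) (S : {set 'I_n})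
    (u : {ffun 'I_n -> 'I_l}) (j : 'I_n) (a b : 'I_l)
    (g : {ffun 'I_n -> 'I_l} -> R) (C X Y : R) :
    j \in S -> 0 <= X -> 0 <= Y ->
    (color_count S u b)%:R * (\sum_(v in local_slice S u | v j == a) g v ^+ 2) =
      C * X ^+ 2 ->
    (color_count S u a)%:R * (\sum_(v in local_slice S u | v j == b) g v ^+ 2) =
      C * Y ^+ 2 ->
  C * (X - Y) ^+ 2 <=
  \sum_(v in local_slice S u | v j == a) \sum_(k in S | v k == b)
     (g v - g (sact v (tperm j k))) ^+ 2.
Proof.
move=> jS X0 Y0 hX hY.
have pairE (h : {ffun 'I_n -> 'I_l} -> 'I_n -> R) :
    \sum_(v in local_slice S u | v j == a) \sum_(k in S | v k == b) h v k =
    \sum_(p : {ffun 'I_n -> 'I_l} * 'I_n |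
      ((p.1 \in local_slice S u) && (p.1 j == a)) &&
      ((p.2 \in S) && (p.1 p.2 == b))) h p.1 p.2.
  by rewrite pair_big_dep.
rewrite pairE; apply: (sqr_sub_norm_le X0 Y0).
  rewrite -(pairE (fun v _ => g v ^+ 2)) -hX mulr_sumr.
  apply: eq_bigr => v /andP[/local_sliceP[_ vu] _].
  rewrite (eq_bigl (fun k => k \in [set k in S | v k == b])) => [|k].
    by rewrite sumr_const -/(color_count S v b) vu mulr_natl.
  by rewrite inE.
by rewrite -(pairE (fun v k => g (sact v (tperm j k)) ^+ 2)) -hY -sum_swap.
Qed.

(** The one-site inequality is applied to the root mean squares [G a] of [g] on the fibers, with the
    colour frequencies [p a] as weights; [fiber_transport] then bounds each [(G a - G b) ^+ 2] by
    swaps with [j]. *)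
Lemma marginal_entropy_le (R : realType) (n l : nat) (S : {set 'I_n})
    (u : {ffun 'I_n -> 'I_l}) (j : 'I_n) (g : {ffun 'I_n -> 'I_l} -> R) :
    j \in S ->
  \sum_a (\sum_(v in local_slice S u | v j == a) g v ^+ 2) *
     ln ((\sum_(v in local_slice S u | v j == a) g v ^+ 2) /
         #|[set v in local_slice S u | v j == a]|%:R) -
   (\sum_(v in local_slice S u) g v ^+ 2) *
     ln ((\sum_(v in local_slice S u) g v ^+ 2) / #|local_slice S u|%:R) <=
  2 / 3 * (2 + log_deficit R S u) / #|S|%:R *
    \sum_(v in local_slice S u) \sum_(k in S) (g v - g (sact v (tperm j k))) ^+ 2.
Proof.
move=> jS; set A := local_slice S u.
pose W : R := #|A|%:R; pose m : R := #|S|%:R.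
pose w a : R := #|[set v in A | v j == a]|%:R.
pose F a := \sum_(v in A | v j == a) g v ^+ 2.
pose kap a : R := (color_count S u a)%:R.
have W0 : 0 < W by rewrite ltr0n; apply/card_gt0P; exists u; exact: local_slice_refl.
have m0 : 0 < m by rewrite ltr0n; apply/card_gt0P; exists j.
have mw a : m * w a = kap a * W by exact: card_local_slice_fiber.
have F0 a : 0 <= F a by apply: sumr_ge0 => v _; exact: sqr_ge0.
pose p a := kap a / m.
pose G a := Num.sqrt (F a / w a).
have wE a : w a = p a * W.
  by apply: (mulfI (lt0r_neq0 m0)); rewrite mw /p; field; rewrite gt_eqF.
have G2 a : G a ^+ 2 = F a / w a by rewrite sqr_sqrtr// divr_ge0// ler0n.
have FE a : F a = w a * G a ^+ 2.
  (* On an empty fiber [F a] is an empty sum, so both sides are zero. *)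
  rewrite G2; have [w0|w0] := eqVneq (w a) 0; last by field.
  rewrite w0 mul0r /F; apply: big1 => v vA.
  have : (0 < #|[set v in A | v j == a]|)%N by apply/card_gt0P; exists v; rewrite inE.
  by rewrite lt0n -(pnatr_eq0 R) -/(w a) w0 eqxx.
have FsumE : \sum_(v in A) g v ^+ 2 = \sum_a F a.
  by rewrite (partition_big (fun v : {ffun 'I_n -> 'I_l} => v j) predT).
have p0 a : 0 <= p a by rewrite divr_ge0 ?ler0n// ltW.
have p1 : \sum_a p a = 1.
  rewrite -mulr_suml -natr_sum sum_color_count divff// gt_eqF//.
pose N := \sum_a p a * G a ^+ 2.
have FWN : \sum_a F a = W * N.
  by rewrite mulr_sumr; apply: eq_bigr => a _; rewrite FE wE; ring.
have pL a : 0 < p a -> - ln (p a) <= log_deficit R S u.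
  move=> pa; rewrite -lnV ?posrE// /p invf_div.
  apply: (@ler_term_sum R _ (fun a => ln (m / kap a)) a) => b.
  exact: ln_color_ratio_ge0.
have := entropy_le_variance p0 p1 (fun a => sqrtr_ge0 _ : 0 <= G a)
  (log_deficit_ge0 R S u) pL.
rewrite -/N; set L := log_deficit R S u => /(ler_wpM2l (ltW W0)).
set lhs := (X in X <= _) => hent.
rewrite FsumE FWN -/W [X in ln X](_ : _ = N); last by field; rewrite gt_eqF.
have -> : \sum_a F a * ln (F a / w a) - W * N * ln N = lhs.
  rewrite /lhs mulrBr mulrA; congr (_ - _); rewrite mulr_sumr.
  by apply: eq_bigr => a _; rewrite -G2 FE wE; ring.
apply: le_trans hent _.
(* The variance is half the mean of [(G a - G b) ^+ 2] over independent pairs; this half turns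
   [4 / 3] into [2 / 3]. *)
have varE : N - (\sum_a p a * G a) ^+ 2 =
    1 / 2 * \sum_a \sum_b p a * p b * (G a - G b) ^+ 2.
  pose M := \sum_a p a * G a.
  transitivity (1 / 2 * \sum_a (p a * G a ^+ 2 + p a * N - 2 * (p a * G a) * M)).
    have e1 : \sum_a p a * N = N by rewrite -mulr_suml p1 mul1r.
    have e2 : \sum_a 2 * (p a * G a) * M = 2 * M * M.
      by rewrite -mulr_suml -mulr_sumr.
    by rewrite sumrB big_split /= e1 e2 -/N -/M; field.
  congr (_ * _); apply: eq_bigr => a _.
  transitivity (\sum_b (p a * G a ^+ 2 * p b + p a * (p b * G b ^+ 2) -
      2 * (p a * G a) * (p b * G b))).
    have e1 : \sum_b p a * (p b * G b ^+ 2) = p a * N by rewrite -mulr_sumr.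
    have e2 : \sum_b 2 * (p a * G a) * (p b * G b) = 2 * (p a * G a) * M.
      by rewrite -mulr_sumr.
    by rewrite sumrB big_split /= e1 e2 -mulr_sumr p1 mulr1.
  by apply: eq_bigr => b _; ring.
rewrite varE.
have C0 : 0 <= 2 / 3 * (2 + L) / m.
  by rewrite divr_ge0 ?(ltW m0)// mulr_ge0 ?addr_ge0 ?log_deficit_ge0//; lra.
apply: (@le_trans _ _ (2 / 3 * (2 + L) / m *
    \sum_a \sum_b kap a * kap b * W / m * (G a - G b) ^+ 2)).
  rewrite le_eqVlt; apply/orP; left; apply/eqP.
  have -> : \sum_a \sum_b kap a * kap b * W / m * (G a - G b) ^+ 2 =
      m * W * \sum_a \sum_b p a * p b * (G a - G b) ^+ 2.
    rewrite mulr_sumr; apply: eq_bigr => a _.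
    rewrite mulr_sumr; apply: eq_bigr => b _.
    by rewrite /p; field; rewrite gt_eqF.
  by field; rewrite gt_eqF.
apply: ler_wpM2l => //.
rewrite (partition_big (fun v : {ffun 'I_n -> 'I_l} => v j) predT)//=.
apply: ler_sum => a _.
under [leRHS]eq_bigr => v _ do rewrite (partition_big v predT)//=.
rewrite exchange_big /=; apply: ler_sum => b _.
apply: fiber_transport => //; rewrite ?sqrtr_ge0//.
  by rewrite -/(F a) FE wE /p /kap; field; rewrite gt_eqF.
by rewrite -/(F b) FE wE /p /kap; field; rewrite gt_eqF.
Qed.

(** * Effect of removing one coordinate on the constant *)

(* [log_gap R 1 = ln (1 / 0) = 0]. *)
Definition log_gap (R : realType) (k : nat) : R := ln (k%:R / k.-1%:R).

Lemma log_gapS (R : realType) (k : nat) :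
  log_gap R k.+2 <= k.+1%:R^-1 /\ 0 <= log_gap R k.+2.
Proof.
have k0 : 0 < k.+1%:R :> R by rewrite ltr0n.
have k1 : k.+2%:R = k.+1%:R + 1 :> R by rewrite -natr1.
split; last by rewrite ln_ge0// ler_pdivlMr// mul1r ler_nat.
apply: le_trans (ln_le_subr1 _) _; first by rewrite divr_gt0// ltr0n.
rewrite /= k1 le_eqVlt; apply/orP; left; apply/eqP.
by move: k.+1%:R k0 => z z0; field; rewrite gt_eqF.
Qed.

Lemma log_gap_lt2 (R : realType) (k : nat) : (k < 2)%N -> log_gap R k = 0.
Proof. by case: k => [|[|]]//= _; rewrite /log_gap /= invr0 mulr0 ln0. Qed.

Lemma log_gap_le_ln2 (R : realType) (k : nat) : log_gap R k <= ln 2.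
Proof.
have [k2|] := ltnP k 2; first by rewrite log_gap_lt2// ln_ge0// ler1n.
case: k => [|[|k]]// _; rewrite ler_ln ?posrE ?divr_gt0 ?ltr0n//.
by rewrite ler_pdivrMr ?ltr0n// -natrM ler_nat; lia.
Qed.

Lemma pred_mul_log_gap_le (R : realType) (k : nat) : k.-1%:R * log_gap R k <= 1.
Proof.
have [k2|] := ltnP k 2; first by rewrite log_gap_lt2// mulr0.
case: k => [|[|k]]// _; have [h _] := log_gapS R k.
by rewrite mulrC -ler_pdivlMr ?ltr0n// mul1r.
Qed.

(** The case [k = 2] is [2 * ln 2 <= 3 / 2]; for [k >= 3] the gap is at most [1 / (k - 1)], and
    [k / (k - 1) <= 3 / 2]. *)
Lemma mul_log_gap_le (R : realType) (k : nat) : k%:R * log_gap R k <= 3 / 2.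
Proof.
have [k2|] := ltnP k 2; first by rewrite log_gap_lt2// mulr0; lra.
case: k => [|[|[|k]]]// _.
  by have := log_gap_le_ln2 R 2; have /andP[_] := ln2_bounds R; lra.
have [h _] := log_gapS R k.+1.
have k0 : 2 <= k.+2%:R :> R by rewrite ler_nat.
have k1 : k.+3%:R = k.+2%:R + 1 :> R by rewrite -natr1.
apply: (@le_trans _ _ (k.+3%:R * k.+2%:R^-1)); first by rewrite ler_wpM2l ?ler0n.
by rewrite ler_pdivrMr; lra.
Qed.

Lemma inv_le_ln_pred (R : realType) (m : nat) :
  (1 < m)%N -> (m%:R : R)^-1 <= ln (m%:R / (m%:R - 1)).
Proof.
move=> m1; have m2 : 1 < m%:R :> R by rewrite ltr1n.
apply: le_trans (ln_ge_subr_inv _); last by rewrite divr_gt0; lra.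
rewrite invf_div le_eqVlt; apply/orP; left; apply/eqP.
by field; rewrite gt_eqF; lra.
Qed.

(* A colour absent from [S] contributes [ln (4 m / 0) = ln 0 = 0]. *)
Definition log_profile (R : realType) (n l : nat) (S : {set 'I_n})
    (v : {ffun 'I_n -> 'I_l}) : R :=
  \sum_a ln (4 * #|S|%:R / (color_count S v a)%:R).

Definition num_colors (n l : nat) (S : {set 'I_n}) (v : {ffun 'I_n -> 'I_l}) :
    nat :=
  (\sum_(a : 'I_l) (0 < color_count S v a))%N.

Lemma log_profileE (R : realType) (n l : nat) (S : {set 'I_n})
    (v : {ffun 'I_n -> 'I_l}) :
  log_profile R S v = log_deficit R S v + (num_colors S v)%:R * (2 * ln 2).
Proof.
rewrite natr_sum mulr_suml -big_split /=; apply: eq_bigr => a _.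
have [->|k0] := posnP (color_count S v a).
  by rewrite invr0 !mulr0 ln0// mul0r addr0.
have m0 : (0 < #|S|)%N by apply: leq_trans k0 (color_count_le _ _ _).
rewrite -mulrA lnM ?posrE ?divr_gt0 ?ltr0n// mul1r addrC; congr (_ + _).
by rewrite (_ : 4 = 2 * 2) ?lnM ?posrE//; lra.
Qed.

(** Each colour present loses [ln (m / (m - 1))] since [m = #|S|] drops by one, while the colour of
    [j] gains the log gap of its count. *)
Lemma log_profileD1_le (R : realType) (n l : nat) (S : {set 'I_n})
    (v : {ffun 'I_n -> 'I_l}) (j : 'I_n) : j \in S -> (1 < #|S|)%N ->
  log_profile R (S :\ j) v <=
  log_profile R S v - (num_colors S v)%:R * ln (#|S|%:R / (#|S|%:R - 1)) +
  log_gap R (color_count S v (v j)).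
Proof.
move=> jS S1; have Sj : #|S :\ j|%:R = #|S|%:R - 1 :> R.
  by rewrite [in RHS](cardsD1 j) jS natrD /=; ring.
have m2 : 1 < #|S|%:R :> R by rewrite ltr1n.
have m10 : 0 < #|S|%:R - 1 :> R by rewrite subr_gt0.
rewrite /num_colors natr_sum mulr_suml -sumrB.
have -> : log_gap R (color_count S v (v j)) =
    \sum_a (v j == a)%:R * log_gap R (color_count S v a).
  rewrite (bigD1 (v j))//= eqxx mul1r big1 ?addr0// => a.
  by rewrite eq_sym => /negPf->; rewrite mul0r.
rewrite -big_split /=; apply: ler_sum => a _; rewrite Sj.
have lnq : ln (#|S|%:R / (#|S|%:R - 1)) = ln #|S|%:R - ln (#|S|%:R - 1) :> R.
  by rewrite ln_div ?posrE//; lra.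
have ln4 (x y : R) : 0 < x -> 0 < y -> ln (4 * x / y) = ln 4 + ln x - ln y.
  by move=> x0 y0; rewrite ln_div ?lnM ?posrE ?mulr_gt0//; lra.
have m0 : 0 < #|S|%:R :> R by lra.
set k := color_count (S :\ j) v a.
rewrite (color_countD1 v a jS) lnq -/k; case: (v j == a) => /=; last first.
  rewrite add0n mul0r addr0; case: posnP => [->|k0].
    by rewrite invr0 !mulr0 ln0//= mul0r subrr.
  have k1 : 0 < k%:R :> R by rewrite ltr0n.
  by rewrite /= mul1r !ln4//; lra.
rewrite add1n !mul1r /log_gap /=.
(* If [j] was the only coordinate of its colour, its term drops to [ln 0 = 0], and the bound follows
   from [ln (4 * (m - 1)) >= 0]. *)
have [->|k0] := posnP k.
  rewrite invr0 !mulr0 !(@ln0 R 0)// divr1 lnM ?posrE//.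
  have : 0 <= ln (4 * (#|S|%:R - 1)) :> R.
    rewrite ln_ge0//.
    have : 2 <= #|S|%:R :> R by rewrite ler_nat.
    lra.
  by rewrite lnM ?posrE//; lra.
have k1 : 0 < k%:R :> R by rewrite ltr0n.
have kS : 0 < k.+1%:R :> R by rewrite ltr0n.
by rewrite !ln4// ln_div ?posrE//; lra.
Qed.

Lemma num_colors_ge2 (n l : nat) (S : {set 'I_n}) (v : {ffun 'I_n -> 'I_l})
    (x y : 'I_n) :
  x \in S -> y \in S -> v x != v y -> (2 <= num_colors S v)%N.
Proof.
move=> xS yS vxy; rewrite /num_colors (bigD1 (v x))//= color_count_gt0//.
rewrite (bigD1 (v y))/=; last by rewrite eq_sym.
by rewrite color_count_gt0//; lia.
Qed.

Lemma card_avoid2 (n : nat) (S : {set 'I_n}) (x y : 'I_n) :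
  x \in S -> y \in S -> x != y ->
  #|[set j in S | (j != x) && (j != y)]|.+2 = #|S|.
Proof.
move=> xS yS xy; rewrite (cardsD1 x S) xS (cardsD1 y (S :\ x)) !inE eq_sym xy yS /=.
congr _.+2; apply: eq_card => j; rewrite !inE.
by case: (j == x); case: (j == y); case: (j \in S).
Qed.

(** Grouped by colour, each colour present contributes at most [3 / 2]. The colours of [x] and [y]
    each have a coordinate left out, so [pred_mul_log_gap_le] bounds their contributions by [1]. *)
Lemma sum_log_gap_le_colors (R : realType) (n l : nat) (S : {set 'I_n})
    (v : {ffun 'I_n -> 'I_l}) (x y : 'I_n) :
    x \in S -> y \in S -> v x != v y ->
  \sum_(j in S | (j != x) && (j != y)) log_gap R (color_count S v (v j)) <=
  3 / 2 * (num_colors S v)%:R - 1.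
Proof.
move=> xS yS vxy; rewrite (partition_big v predT)//=.
have ind (c : 'I_l) : \sum_a (a == c)%:R = 1 :> R.
  rewrite (bigD1 c)//= eqxx big1 ?addr0// => a /negPf->//.
have -> : 3 / 2 * (num_colors S v)%:R - 1 =
    \sum_a (3 / 2 * (0 < color_count S v a)%:R -
      1 / 2 * (a == v x)%:R - 1 / 2 * (a == v y)%:R) :> R.
  by rewrite !sumrB -!mulr_sumr !ind natr_sum; lra.
apply: ler_sum => a _.
rewrite (eq_bigr (fun=> log_gap R (color_count S v a))); last first.
  by move=> j /andP[_ /eqP->].
rewrite sumr_const -mulr_natl.
set c := #|_|; have g0 : 0 <= log_gap R (color_count S v a).
  have [k2|] := ltnP (color_count S v a) 2; first by rewrite log_gap_lt2.
  by case: (color_count S v a) => [|[|k]]// _; have [] := log_gapS R k.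
have sub z : z \in S -> (z == x) || (z == y) -> v z = a ->
    (c <= (color_count S v a).-1)%N.
  move=> zS zxy vz; rewrite /color_count (cardsD1 z) inE zS vz eqxx /=.
  apply: subset_leq_card; apply/fintype.subsetP => j.
  rewrite !inE => /andP[/andP[jS /andP[jx jy]] ->]; rewrite jS !andbT.
  by case/orP: zxy => /eqP->.
have subT : (c <= color_count S v a)%N.
  apply: subset_leq_card; apply/fintype.subsetP => j.
  by rewrite !inE => /andP[/andP[-> _] ->].
have cz z : z \in S -> (z == x) || (z == y) -> v z = a ->
    c%:R * log_gap R (color_count S v a) <= 1.
  move=> zS zxy vz; apply: le_trans (pred_mul_log_gap_le R (color_count S v a)).
  by rewrite ler_wpM2r// ler_nat (sub z).
have [ax|ax] := eqVneq a (v x).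
  have := cz x xS (eqP _); rewrite eqxx => /(_ isT (esym ax)).
  by rewrite ax (negPf vxy) color_count_gt0//=; lra.
have [ay|ay] := eqVneq a (v y).
  have := cz y yS; rewrite eqxx orbT => /(_ isT (esym ay)).
  by rewrite ay color_count_gt0//=; lra.
have [k0|k0] := posnP (color_count S v a).
  by rewrite log_gap_lt2 ?k0//=; lra.
have := mul_log_gap_le R (color_count S v a).
have : c%:R * log_gap R (color_count S v a) <=
    (color_count S v a)%:R * log_gap R (color_count S v a).
  by rewrite ler_wpM2r// ler_nat.
by rewrite /=; lra.
Qed.

Lemma sum_log_gap_le_card (R : realType) (n l : nat) (S : {set 'I_n})
    (v : {ffun 'I_n -> 'I_l}) (x y : 'I_n) :
    x \in S -> y \in S -> x != y ->
  \sum_(j in S | (j != x) && (j != y)) log_gap R (color_count S v (v j)) <=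
  (#|S|%:R - 2) * ln 2.
Proof.
move=> xS yS xy.
apply: (@le_trans _ _ (\sum_(j in [set j in S | (j != x) && (j != y)]) ln 2)).
  rewrite [leRHS](eq_bigl (fun j => (j \in S) && ((j != x) && (j != y)))).
    by apply: ler_sum => j _; exact: log_gap_le_ln2.
  by move=> j; rewrite inE.
have cE : #|[set j in S | (j != x) && (j != y)]|%:R = #|S|%:R - 2 :> R.
  by rewrite -(card_avoid2 xS yS xy) -natr1 -natr1; ring.
by rewrite sumr_const -[leLHS]mulr_natl cE.
Qed.

(* [swap_rate_step] multiplied by [2 * t * (m - 1)], with [t = ln 2], [r] the
   number of colours present, [D] the log deficit, [X] the sum of the log gaps
   and [q = ln (m / (m - 1))]. *)
Lemma swap_rate_arithmetic (R : realType) (m r : nat) (t X q D : R) :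
    (3 <= m)%N -> (2 <= r)%N -> 2 / 3 <= t <= 3 / 4 -> m%:R^-1 <= q -> 0 <= D ->
    X <= 3 / 2 * r%:R - 1 -> X <= (m%:R - 2) * t ->
  2 * t * (2 / 3 * (2 + D)) * (m%:R - 1) / m%:R + X * (m%:R - 1) / (m%:R - 2) <=
  D + r%:R * (2 * t) + (m%:R - 1) * r%:R * q.
Proof.
move=> m3 r2 /andP[t1 t2] hq D0 X1 X2.
have M3 : 3 <= m%:R :> R by rewrite ler_nat.
have r0 : 2 <= r%:R :> R by rewrite ler_nat.
(* This is what is left, divided by [c = (m - 1) / m], once [q] is replaced by [1 / m] and
   [4 / 3 * t * D * c] is absorbed by [D], which uses [t <= 3 / 4]. *)
have main : 8 / 3 * t + X * m%:R / (m%:R - 2) <=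
    2 * r%:R * t * (m%:R / (m%:R - 1)) + r%:R.
  have [r3|r3] := ltnP 2 r.
    have {r0}r3' : 3 <= r%:R :> R by rewrite ler_nat.
    have -> : X * m%:R / (m%:R - 2) = X + 2 * (X / (m%:R - 2)).
      by field; rewrite gt_eqF; lra.
    have XM : X / (m%:R - 2) <= t by rewrite ler_pdivrMr; lra.
    have Z1 : 1 <= m%:R / (m%:R - 1) :> R by rewrite ler_pdivlMr; lra.
    have : 2 * r%:R * t * 1 <= 2 * r%:R * t * (m%:R / (m%:R - 1)).
      by rewrite ler_wpM2l// !mulr_ge0//; lra.
    have : 0 <= (r%:R - 3) * (t - 2 / 3) by rewrite mulr_ge0; lra.
    lra.
  (* With two colours [X <= 2]; this is used for [m >= 6], and [X <= (m - 2) * t] for smaller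
     [m]. *)
  have rE : r = 2%N by apply/eqP; rewrite eqn_leq r3 r2.
  rewrite rE in X1 *; have X3 : X <= 2 by lra.
  have [m6|m6] := leqP 6 m; last first.
    have M5 : m%:R <= 5 :> R by rewrite ler_nat -ltnS.
    have XM : X / (m%:R - 2) <= t by rewrite ler_pdivrMr; lra.
    have M0 : 0 <= m%:R :> R by lra.
    have := ler_wpM2r M0 XM; rewrite mulrAC.
    have : t * m%:R <= t * 5 by rewrite ler_wpM2l; lra.
    have Z : 5 / 4 <= m%:R / (m%:R - 1) :> R by rewrite ler_pdivlMr; lra.
    have : t * (5 / 4) <= t * (m%:R / (m%:R - 1)) by rewrite ler_wpM2l; lra.
    lra.
  have M6 : 6 <= m%:R :> R by rewrite ler_nat.
  have -> : m%:R / (m%:R - 1) = 1 + (m%:R - 1)^-1 :> R.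
    by field; rewrite gt_eqF; lra.
  have i0 : 0 <= (m%:R - 1)^-1 :> R by rewrite invr_ge0; lra.
  have : X * m%:R / (m%:R - 2) <= 2 + 4 * (m%:R - 2)^-1.
    have -> : 2 + 4 * (m%:R - 2)^-1 = 2 * m%:R / (m%:R - 2) :> R.
      by field; rewrite gt_eqF; lra.
    by rewrite ler_wpM2r ?invr_ge0 ?ler_wpM2r//; lra.
  have : 0 <= (t - 2 / 3) * (m%:R - 1)^-1 by rewrite mulr_ge0//; lra.
  (* The numbers [8 / 9] and [8 / 3] are [4 / 3 * t] and [4 * t] at the lower bound [t = 2 / 3]. *)
  have : 4 * (m%:R - 2)^-1 <= 8 / 9 + 8 / 3 * (m%:R - 1)^-1 :> R.
    have [m7|m7] := leqP 7 m; last first.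
      have M6' : m%:R <= 6 :> R by rewrite ler_nat -ltnS.
      have : (m%:R - 2)^-1 <= 1 / 4 :> R by rewrite -[leLHS]div1r ler_pdivrMr; lra.
      have : 1 / 5 <= (m%:R - 1)^-1 :> R by rewrite -[leRHS]div1r ler_pdivlMr; lra.
      lra.
    have M7 : 7 <= m%:R :> R by rewrite ler_nat.
    have : (m%:R - 2)^-1 <= 1 / 5 :> R by rewrite -[leLHS]div1r ler_pdivrMr; lra.
    lra.
  lra.
have c0 : 0 <= (m%:R - 1) / m%:R :> R by rewrite divr_ge0; lra.
have := ler_wpM2l c0 main.
set c := (m%:R - 1) / m%:R in c0 *.
have c1 : c <= 1 by rewrite ler_pdivrMr; lra.
have -> : c * (8 / 3 * t + X * m%:R / (m%:R - 2)) =
    2 * t * (2 / 3 * 2) * c + X * (m%:R - 1) / (m%:R - 2).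
  by rewrite /c; field; apply/andP; split; rewrite gt_eqF//; lra.
have -> : c * (2 * r%:R * t * (m%:R / (m%:R - 1)) + r%:R) =
    r%:R * (2 * t) + (m%:R - 1) * r%:R * m%:R^-1.
  by rewrite /c; field; apply/andP; split; rewrite gt_eqF//; lra.
have : (m%:R - 1) * r%:R * m%:R^-1 <= (m%:R - 1) * r%:R * q.
  by rewrite ler_wpM2l// mulr_ge0//; lra.
have : t * D * c <= 3 / 4 * D.
  have : t * D <= 3 / 4 * D by rewrite ler_wpM2r.
  have : t * D * c <= t * D * 1 by rewrite ler_wpM2l// mulr_ge0//; lra.
  lra.
have -> : 2 * t * (2 / 3 * (2 + D)) * (m%:R - 1) / m%:R =
    2 * t * (2 / 3 * 2) * c + 4 / 3 * (t * D * c).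
  by rewrite /c; field; rewrite gt_eqF//; lra.
lra.
Qed.

(* The target constant [m / 2 * sum_a log2 (4 m / k_a)] divided by the number
   [m * (m - 1)] of ordered pairs of distinct coordinates. *)
Definition swap_rate (R : realType) (n l : nat) (S : {set 'I_n})
    (v : {ffun 'I_n -> 'I_l}) : R :=
  log_profile R S v / (2 * ln 2 * (#|S|%:R - 1)).

(** Compares coefficients of the squared difference for the pair [(x, y)] in the induction: the
    first term comes from the marginal at [x], the sum from the smaller slices in which [x] and [y]
    are both still free. *)
Lemma swap_rate_step (R : realType) (n l : nat) (S : {set 'I_n})
    (v : {ffun 'I_n -> 'I_l}) (x y : 'I_n) :
    x \in S -> y \in S -> v x != v y ->
  2 / 3 * (2 + log_deficit R S v) / #|S|%:R +
    \sum_(j in S | (j != x) && (j != y)) swap_rate R (S :\ j) v <=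
  #|S|%:R * swap_rate R S v.
Proof.
move=> xS yS vxy; have xy : x != y by apply: contraNneq vxy => ->.
have S2 : (2 <= #|S|)%N by rewrite -(card_avoid2 xS yS xy).
have r2 := num_colors_ge2 xS yS vxy.
have t23 := ln2_bounds R; have /andP[t2 t3] := t23.
have D0 := log_deficit_ge0 R S v.
rewrite /swap_rate log_profileE.
move: (sum_log_gap_le_card R v xS yS xy) (log_profileE R S v) D0 t23 t2 t3.
move: (ln 2) (log_deficit R S v) => t D X2 hE D0 t23 t2 t3.
have t0 : t != 0 by rewrite gt_eqF; lra.
(* For two free coordinates the sum is empty; this case is apart because [m - 2] is a denominator
   below. *)
have [m2|m3] := leqP #|S| 2.
  have Sm : #|S| = 2%N by apply/eqP; rewrite eqn_leq m2 S2.
  rewrite big_pred0 => [|j]; last first.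
    have /eqP := card_avoid2 xS yS xy; rewrite Sm !eqSS cards_eq0 => /eqP h.
    by have := finset.in_set0 j; rewrite -h inE.
  rewrite Sm addr0.
  have r2' : 2 <= (num_colors S v)%:R :> R by rewrite ler_nat.
  have -> : 2%:R * ((D + (num_colors S v)%:R * (2 * t)) / (2 * t * (2%:R - 1))) =
     D / t + 2 * (num_colors S v)%:R by field.
  have : D <= D / t by rewrite ler_pdivlMr; [rewrite -[leRHS]mulr1 ler_wpM2l|]; lra.
  lra.
have m3' : 3 <= #|S|%:R :> R by rewrite ler_nat.
have q1 : (#|S|%:R : R)^-1 <= ln (#|S|%:R / (#|S|%:R - 1)) by exact: inv_le_ln_pred.
have X1 := sum_log_gap_le_colors R xS yS vxy.
set X := \sum_(j in S | _) _ in X1 X2.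
have := swap_rate_arithmetic m3 r2 t23 q1 D0 X1 X2.
set q := ln _; set r : R := (num_colors S v)%:R; set m : R := #|S|%:R.
move=> main.
have sumh : \sum_(j in S | (j != x) && (j != y)) log_profile R (S :\ j) v <=
    (m - 2) * (D + r * (2 * t) - r * q) + X.
  apply: (@le_trans _ _ (\sum_(j in S | (j != x) && (j != y))
      (D + r * (2 * t) - r * q + log_gap R (color_count S v (v j))))).
    apply: ler_sum => j /andP[jS _].
    by have := log_profileD1_le R v jS (ltnW m3); rewrite hE.
  rewrite big_split /= lerD2r.
  have cE : #|[set j in S | (j != x) && (j != y)]|%:R = m - 2 :> R.
    by rewrite /m -(card_avoid2 xS yS xy) -natr1 -natr1; ring.
  rewrite (eq_bigl (fun j => j \in [set j in S | (j != x) && (j != y)])).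
    by rewrite sumr_const -[leLHS]mulr_natl cE.
  by move=> j; rewrite inE.
apply: (@le_trans _ _ (2 / 3 * (2 + D) / m +
    ((m - 2) * (D + r * (2 * t) - r * q) + X) / (2 * t * (m - 2)))).
  rewrite lerD2l.
  rewrite (eq_bigr (fun j => log_profile R (S :\ j) v * (2 * t * (m - 2))^-1)).
    by rewrite -mulr_suml ler_wpM2r// invr_ge0 !mulr_ge0//; lra.
  move=> j /andP[jS _]; congr (_ / (_ * _)).
  by rewrite /m (cardsD1 j S) jS natrD /=; ring.
have c0 : 0 <= (2 * t * (m - 1))^-1 by rewrite invr_ge0 !mulr_ge0//; lra.
have := ler_wpM2r c0 main.
have m10 : m - 1 != 0 by rewrite gt_eqF//; lra.
have m20 : m - 2 != 0 by rewrite gt_eqF//; lra.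
have mn0 : m != 0 by rewrite gt_eqF//; lra.
(* The two differences agree: the goal is [main] divided by [2 * t * (m - 1)]. *)
rewrite -subr_ge0 => h; rewrite -subr_ge0; apply: le_trans h _.
rewrite le_eqVlt; apply/orP; left; apply/eqP.
by field; rewrite t0 m10 m20 mn0.
Qed.

(** * Induction on the free coordinates *)

(** Ordered pairs are summed, so each transposition counts twice; the diagonal contributes zero. *)
Definition swap_energy (R : realType) (n l : nat)
    (g : {ffun 'I_n -> 'I_l} -> R) (S : {set 'I_n}) (v : {ffun 'I_n -> 'I_l}) :
    R :=
  \sum_(x in S) \sum_(y in S) (g v - g (sact v (tperm x y))) ^+ 2.

Lemma sum_swap_energyD1 (R : realType) (n l : nat)
    (g : {ffun 'I_n -> 'I_l} -> R) (S : {set 'I_n}) (v : {ffun 'I_n -> 'I_l})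
    (c : 'I_n -> R) :
  \sum_(j in S) c j * swap_energy g (S :\ j) v =
  \sum_(x in S) \sum_(y in S)
    (\sum_(j in S | (j != x) && (j != y)) c j) *
    (g v - g (sact v (tperm x y))) ^+ 2.
Proof.
transitivity (\sum_(j in S) \sum_(x in S | j != x) \sum_(y in S | j != y)
    c j * (g v - g (sact v (tperm x y))) ^+ 2).
  apply: eq_bigr => j _; rewrite mulr_sumr.
  apply: eq_big => [x|x _]; first by rewrite !inE andbC eq_sym.
  by rewrite mulr_sumr; apply: eq_bigl => y; rewrite !inE andbC eq_sym.
rewrite (exchange_big_dep [in S])/=; last by move=> ? ? _ /andP[].
apply: eq_bigr => x xS.
rewrite (exchange_big_dep [in S])/=; last by move=> ? ? _ /andP[].
apply: eq_bigr => y yS; rewrite mulr_suml; apply: eq_bigl => j.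
by rewrite xS yS -andbA.
Qed.

Lemma sact_tperm_id (n l : nat) (v : {ffun 'I_n -> 'I_l}) (x y : 'I_n) :
  v x = v y -> sact v (tperm x y) = v.
Proof. by move=> vxy; apply/ffunP => j; rewrite ffunE; case: tpermP => [->|->|]. Qed.

Lemma log_deficit_local_slice (R : realType) (n l : nat) (S : {set 'I_n})
    (u v : {ffun 'I_n -> 'I_l}) :
  v \in local_slice S u -> log_deficit R S v = log_deficit R S u.
Proof. by move=> /local_sliceP[_ vu]; apply: eq_bigr => a _; rewrite vu. Qed.

(** The rate stays inside the sum because on [S :\ j] it depends on the colour [v j]. The bounds on
    the fibers then add up, and the comparison can be made string by string and pair by pair. *)
Lemma entropy_local_slice_le (R : realType) (n l : nat)
    (g : {ffun 'I_n -> 'I_l} -> R) (S : {set 'I_n}) (u : {ffun 'I_n -> 'I_l}) :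
  entropy_on (local_slice S u) (fun v => g v ^+ 2) <=
  \sum_(v in local_slice S u) swap_rate R S v * swap_energy g S v.
Proof.
have [m mS] := ubnP #|S|; elim: m => // m IH in S u mS *.
have [->|/finset.set0Pn[j0 j0S]] := eqVneq S finset.set0.
  have -> : local_slice finset.set0 u = [set u].
    apply/setP => v; rewrite finset.in_set1; apply/local_sliceP/eqP => [[h _]|->//].
    by apply/ffunP => j; apply: h; rewrite inE.
  rewrite /entropy_on !big_set1 cards1 divr1 subrr.
  by rewrite /swap_energy big_set0 mulr0.
have m0 : 0 < #|S|%:R :> R by rewrite ltr0n; apply/card_gt0P; exists j0.
(* After multiplication by [#|S|], one copy of the entropy is split along each [j] in [S]. *)
rewrite -(ler_pM2l m0) [leLHS]mulr_natl -[leLHS]sumr_const.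
set A := local_slice S u.
pose K (v : {ffun 'I_n -> 'I_l}) : R := 2 / 3 * (2 + log_deficit R S v) / #|S|%:R.
have fiber_le : \sum_(j in S) entropy_on A (fun v => g v ^+ 2) <=
    \sum_(j in S) \sum_(v in A)
    (swap_rate R (S :\ j) v * swap_energy g (S :\ j) v +
     K v * \sum_(k in S) (g v - g (sact v (tperm j k))) ^+ 2).
  apply: ler_sum => j jS.
  rewrite (entropy_on_chain _ _ (fun v : {ffun 'I_n -> 'I_l} => v j)).
  rewrite [leRHS]big_split /=; apply: lerD; last first.
    apply: le_trans (marginal_entropy_le u g jS) _.
    rewrite mulr_sumr le_eqVlt; apply/orP; left; apply/eqP.
    by apply: eq_bigr => v vA; rewrite /K (log_deficit_local_slice R vA).
  rewrite [leRHS](partition_big (fun v : {ffun 'I_n -> 'I_l} => v j) predT)//=.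
  apply: ler_sum => a _.
  have [A0|[w]] := set_0Vmem [set v in A | v j == a].
    rewrite A0 /entropy_on !big_set0 mul0r subrr big_pred0// => v.
    by have := finset.in_set0 v; rewrite -A0 inE.
  rewrite inE => /andP[wA /eqP wa].
  rewrite [leRHS](eq_bigl (fun v => v \in [set v in A | v j == a])) => [|v].
    rewrite -wa (local_slice_fiber jS wA); apply: IH.
    by move: mS; rewrite (cardsD1 j S) jS.
  by rewrite inE.
apply: le_trans fiber_le _.
rewrite exchange_big /= mulr_sumr; apply: ler_sum => v _.
rewrite big_split /= sum_swap_energyD1 -mulr_sumr.
rewrite mulrA [in leRHS]/swap_energy !mulr_sumr -big_split /=.
apply: ler_sum => x xS; rewrite !mulr_sumr -big_split /=.
apply: ler_sum => y yS.
(* Swapping equal colours leaves [v] unchanged, so both sides vanish. *)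
have [vxy|vxy] := eqVneq (v x) (v y).
  by rewrite sact_tperm_id// subrr expr0n /= !mulr0 addr0.
by rewrite -mulrDl ler_wpM2r ?sqr_ge0// addrC swap_rate_step.
Qed.

(** * From local slices to the multislice and its transposition chain *)

Lemma tperm_eq_pair (T : finType) (x y a b : T) :
  a != b -> tperm a b = tperm x y -> (a, b) = (x, y) \/ (a, b) = (y, x).
Proof.
move=> ab /(congr1 (fun s : {perm T} => s a)); rewrite tpermL.
by case: tpermP => [-> ->|-> ->|_ _ ba]; [left|right|rewrite ba eqxx in ab].
Qed.

(** A transposition arises from exactly two ordered pairs, [(x, y)] and [(y, x)]. *)
Lemma sum_Trans (R : realType) (n : nat) (F : 'S_n -> R) :
  \sum_(p : 'I_n * 'I_n | p.1 != p.2) F (tperm p.1 p.2) =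
  2 * \sum_(t in Trans n) F t.
Proof.
rewrite (partition_big (fun p : 'I_n * 'I_n => tperm p.1 p.2) [in Trans n]) /=.
  rewrite mulr_sumr; apply: eq_bigr => t /imsetP[[x y]]; rewrite inE /= => xy ->.
  rewrite (eq_bigr (fun=> F (tperm x y))); last by move=> p /andP[_ /eqP->].
  rewrite (eq_bigl (fun p => p \in [set (x, y); (y, x)]%SET)) => [|[a b]].
    by rewrite sumr_const cards2 xpair_eqE negb_and xy /= mulr_natl.
  rewrite !inE /=; apply/andP/idP => [[ab /eqP /(tperm_eq_pair ab) []->]|].
  - by rewrite eqxx.
  - by rewrite eqxx orbT.
  - case/orP => /eqP[-> ->]; split=> //; first by rewrite eq_sym.
    by rewrite tpermC.
by move=> p pp; apply/imsetP; exists p => //; rewrite inE.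
Qed.

Lemma card_Trans (R : realType) (n : nat) :
  2 * #|Trans n|%:R = n%:R * (n%:R - 1) :> R.
Proof.
rewrite -sum1_card natr_sum -(@sum_Trans R n (fun=> 1)).
rewrite -(pair_big_dep predT (fun x y : 'I_n => x != y) (fun _ _ => 1)) /=.
rewrite (eq_bigr (fun=> n%:R - 1)); last first.
  move=> x _; have : \sum_(y < n) 1 = n%:R :> R by rewrite sumr_const card_ord.
  rewrite (bigD1 x)//= => <-; rewrite addrC addrK.
  by apply: eq_bigl => y; rewrite eq_sym.
by rewrite sumr_const card_ord mulr_natl.
Qed.

Lemma Eunif_Trans (R : realType) (n l : nat) (g : {ffun 'I_n -> 'I_l} -> R)
    (v : {ffun 'I_n -> 'I_l}) :
  Eunif (Trans n) (fun t => (g v - g (sact v t)) ^+ 2) =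
  swap_energy g [set: 'I_n] v / (n%:R * (n%:R - 1)).
Proof.
rewrite -card_Trans /Eunif.
have -> : swap_energy g [set: 'I_n] v =
    2 * \sum_(t in Trans n) (g v - g (sact v t)) ^+ 2.
  rewrite -(sum_Trans (fun t => (g v - g (sact v t)) ^+ 2)) /swap_energy.
  rewrite pair_big /= big_mkcond [RHS]big_mkcond /=; apply: eq_bigr => -[x y] _ /=.
  rewrite !finset.in_setT /=.
  by case: eqVneq => // ->; rewrite sact_tperm_id// subrr expr0n.
by rewrite -mulf_div divff ?mul1r// pnatr_eq0.
Qed.

Lemma color_count_setT (n l : nat) (v : {ffun 'I_n -> 'I_l}) (a : 'I_l) :
  color_count [set: 'I_n] v a = #|[set j | v j == a]%SET|.
Proof. by apply: eq_card => j; rewrite !inE. Qed.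

Lemma multisliceP (n l : nat) (kappa : 'I_l -> nat) (v : {ffun 'I_n -> 'I_l}) :
  reflect (forall a, color_count [set: 'I_n] v a = kappa a)
          (v \in multislice n kappa).
Proof.
rewrite inE; apply: (iffP forallP) => h a.
  by rewrite color_count_setT; apply/eqP.
by rewrite -color_count_setT; apply/eqP.
Qed.

Lemma multislice_local (n l : nat) (kappa : 'I_l -> nat)
    (u : {ffun 'I_n -> 'I_l}) :
  u \in multislice n kappa -> multislice n kappa = local_slice [set: 'I_n] u.
Proof.
move=> /multisliceP uk; apply/setP => v.
apply/multisliceP/local_sliceP => [vk|[_ vk] a].
  by split=> [j|a]; rewrite ?inE// vk uk.
by rewrite vk uk.
Qed.

Lemma multislice_nonempty (n l : nat) (kappa : 'I_l -> nat) :
  (\sum_(i < l) kappa i)%N = n -> exists u, u \in multislice n kappa.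
Proof.
move=> kn; pose s := flatten [seq nseq (kappa i) i | i <- enum 'I_l].
have countE a : count_mem a s = kappa a.
  rewrite count_flatten -map_comp sumnE big_map big_enum /=.
  rewrite (bigD1 a)//= count_nseq /= eqxx mul1n big1 ?addn0// => i ia.
  by rewrite count_nseq /= (negPf ia).
have sn : size s == n.
  rewrite size_flatten /shape -map_comp sumnE big_map big_enum /= -kn.
  by apply/eqP; apply: eq_bigr => i _; rewrite size_nseq.
pose t := Tuple sn; have tE : s = map (tnth t) (enum 'I_n) by rewrite map_tnth_enum.
exists [ffun j => tnth t j]; apply/multisliceP => a.
rewrite color_count_setT -countE tE count_map -size_filter cardE.
rewrite enumT {1}/enum_mem; congr size; apply: eq_filter => j.
by rewrite -[LHS]/(j \in [set i | [ffun k => tnth t k] i == a]%SET) inE ffunE.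
Qed.

(** Swapping coordinates of two different colours gives a second string; [log_sobolev_constant_max]
    can then be used. *)
Lemma card_multislice_gt1 (n l : nat) (kappa : 'I_l -> nat)
    (u : {ffun 'I_n -> 'I_l}) : (2 <= l)%N -> (forall i, (0 < kappa i)%N) ->
  u \in multislice n kappa -> (1 < #|multislice n kappa|)%N.
Proof.
move=> l2 k0 uU; have /multisliceP uk := uU.
have color (a : 'I_l) : exists j, u j = a.
  have := k0 a; rewrite -uk => /card_gt0P[j]; rewrite inE => /andP[_ /eqP <-].
  by exists j.
have [x ux] := color (Ordinal (ltnW l2)); have [y uy] := color (Ordinal l2).
have u2 : sact u (tperm x y) \in multislice n kappa.
  by rewrite (multislice_local uU) local_slice_tperm ?finset.in_setT// local_slice_refl.
apply/card_gt1P; exists u, (sact u (tperm x y)); split=> //.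
apply/eqP => /ffunP/(_ x); rewrite ffunE tpermL ux uy => /(congr1 val).
by [].
Qed.

Theorem theorem1p1 (R : realType) (l n : nat) (kappa : 'I_l -> nat)
    (l_ge2 : (2 <= l)%N)
    (kappa_gt0 : forall i : 'I_l, (0 < kappa i)%N)
    (kappa_sum : (\sum_(i < l) kappa i)%N = n) :
  0 < log_sobolev_constant R n kappa /\
  (log_sobolev_constant R n kappa)^-1 <=
    n%:R * \sum_(i < l) 2^-1 * log2 (4 * n%:R / (kappa i)%:R).
Proof.
have [u uU] := multislice_nonempty kappa_sum.
have U1 := card_multislice_gt1 l_ge2 kappa_gt0 uU.
have /multisliceP uk := uU; have UE := multislice_local uU.
have n2 : (2 <= n)%N.
  rewrite -kappa_sum; apply: leq_trans l_ge2 _.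
  by rewrite -[leqLHS]card_ord -sum1_card leq_sum.
have n2' : 2 <= n%:R :> R by rewrite ler_nat.
have ln2_gt0 : 0 < ln 2 :> R by have /andP[] := ln2_bounds R; lra.
set B := n%:R * _.
have BE : B = swap_rate R [set: 'I_n] u * (n%:R * (n%:R - 1)).
  rewrite /swap_rate cardsT card_ord.
  have -> : log_profile R [set: 'I_n] u =
      ln 2 * \sum_(i < l) log2 (4 * n%:R / (kappa i)%:R).
    rewrite mulr_sumr; apply: eq_bigr => a _.
    by rewrite cardsT card_ord uk /log2; field; rewrite gt_eqF.
  by rewrite /B -mulr_sumr; field; apply/andP; split; rewrite gt_eqF//; lra.
have B0 : 0 < B.
  have l0 : (0 < l)%N by exact: ltnW.
  have term_gt0 (i : 'I_l) : 0 < 2^-1 * log2 (4 * n%:R / (kappa i)%:R) :> R.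
    rewrite mulr_gt0 ?invr_gt0// divr_gt0// ln_gt0// ltr_pdivlMr ?ltr0n// mul1r.
    have : (kappa i)%:R <= n%:R :> R.
      have := color_count_le [set: 'I_n] u i.
      by rewrite cardsT card_ord uk ler_nat.
    lra.
  rewrite mulr_gt0//; first by lra.
  by rewrite (bigD1 (Ordinal l0))//= ltr_pwDl ?sumr_ge0// => i _; exact: ltW.
have [_ max] := log_sobolev_constant_max R U1.
(* By maximality it suffices that [B^-1] is admissible in the log-Sobolev inequality. *)
have inv_le : B^-1 <= log_sobolev_constant R n kappa.
  apply: max => phi [phi0 phi1]; rewrite -(ler_pM2l B0) mulrA divff ?gt_eqF// mul1r.
  have Upos : 0 < #|multislice n kappa|%:R :> R by rewrite ltr0n ltnW.
  pose g v := Num.sqrt (phi v).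
  have g2 v : v \in multislice n kappa -> g v ^+ 2 = phi v.
    by move=> /phi0 ?; rewrite sqr_sqrtr.
  have sum_phi : \sum_(v in multislice n kappa) phi v = #|multislice n kappa|%:R.
    by move: phi1; rewrite /Eunif => /(canRL (mulfVK (lt0r_neq0 Upos))); rewrite mul1r.
  rewrite /KL /sqrt_energy /Eunif mulrA ler_pM2r ?invr_gt0//.
  have := entropy_local_slice_le g [set: 'I_n] u; rewrite -UE.
  (* The density has mean one, so the mean term of the entropy is a multiple of [ln 1 = 0]. *)
  rewrite /entropy_on (eq_bigr _ g2) sum_phi divff ?gt_eqF// ln1 mulr0 subr0.
  rewrite (eq_bigr (fun v => phi v * ln (phi v))) => [|v vU]; last by rewrite g2.
  move=> /le_trans; apply; rewrite mulr_sumr le_eqVlt; apply/orP; left; apply/eqP.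
  apply: eq_bigr => v; rewrite UE => vU.
  rewrite -[X in B * X]/(Eunif (Trans n) (fun t => (g v - g (sact v t)) ^+ 2)).
  rewrite Eunif_Trans BE.
  (* The rate depends only on the colour counts, which are constant on the multislice. *)
  have -> : swap_rate R [set: 'I_n] v = swap_rate R [set: 'I_n] u.
    have /local_sliceP[_ vu] := vU; congr (_ / _).
    by apply: eq_bigr => a _; rewrite vu.
  by field; apply/andP; split; rewrite gt_eqF//; lra.
have rho0 : 0 < log_sobolev_constant R n kappa.
  by apply: lt_le_trans inv_le; rewrite invr_gt0.
by split => //; rewrite -[leRHS]invrK lef_pV2// posrE// invr_gt0.
Qed.
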